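(* Let $R$ be a ring. Then the functor $\operatorname{coker}: R\text{-}\mathbf{fpres}\to R\text{-}\mathbf{fpmod}$, which sends a finite left presentation matrix $\mathtt{M}\in R^{r_1\times r_0}$ to the left $R$-module $\operatorname{coker}\mathtt{M}=R^{1\times r_0}/R^{1\times r_1}\mathtt{M}$ and sends a morphism represented by a matrix to the induced $R$-module homomorphism of cokernels, is an equivalence of categories.
   Context: Rings are associative with $1$, not necessarily commutative. $R\text{-}\mathbf{fpmod}$ is the category of finitely presented left $R$-modules. $R\text{-}\mathbf{fpres}$ is the category of finite left $R$-presentations, defined as follows. Objects are finite matrices over $R$ (sizes allowed to be $0$), where two matrices $\mathtt M\in R^{r_1\times r_0}$ and $\mathtt M'\in R^{r_1'\times r_0}$ with the same number of columns are identified to one object if $R^{1\times r_1}\mathtt M=R^{1\times r_1'}\mathtt M'$ as $R$-submodules of $R^{1\times r_0}$. The set $\operatorname{Hom}_{R\text{-}\mathbf{fpres}}(\mathtt M,\mathtt L)$ of morphisms between $\mathtt M\in R^{r_1\times r_0}$ and $\mathtt L\in R^{r_1'\times r_0'}$ is the set of all $r_0\times r_0'$-matrices $\varphi$ over $R$ with $R^{1\times r_1}\mathtt M\varphi\le R^{1\times r_1'}\mathtt L$, where two matrices $\varphi_1,\varphi_2$ are identified to one morphism if they induce (by right multiplication) the same $R$-module homomorphism from $\operatorname{coker}\mathtt M$ to $\operatorname{coker}\mathtt L$. The composite of $\varphi:\mathtt M\to\mathtt L$ followed by $\psi:\mathtt L\to\mathtt N$ is the matrix product $\varphi\psi$. 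*)

(* Defs.v *)
From HB Require Import structures.
From mathcomp Require Import all_boot all_algebra.
From mathcomp Require Import boolp.

Set Implicit Arguments.
Unset Strict Implicit.
Unset Printing Implicit Defensive.

Import GRing.Theory.
Local Open Scope ring_scope.
Local Open Scope quotient_scope.

(* Composition is written in diagrammatic order: [comp f g] is f followed by
   g. *)
Record category := Category {
  obj :> Type;
  hom : obj -> obj -> Type;
  idm : forall A, hom A A;
  comp : forall A B C, hom A B -> hom B C -> hom A C;
  comp_idl : forall A B (f : hom A B), comp (idm A) f = f;
  comp_idr : forall A B (f : hom A B), comp f (idm B) = f;
  compA : forall A B C D (f : hom A B) (g : hom B C) (h : hom C D),
    comp f (comp g h) = comp (comp f g) h
}.

Arguments hom {c} A B.
Arguments idm {c} A.
Arguments comp {c A B C} f g.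

Record functor (C D : category) := Functor {
  fobj :> C -> D;
  fmap : forall A B : C, hom A B -> hom (fobj A) (fobj B);
  fmap_id : forall A : C, fmap (idm A) = idm (fobj A);
  fmap_comp : forall (A B E : C) (f : hom A B) (g : hom B E),
    fmap (comp f g) = comp (fmap f) (fmap g)
}.

Arguments fmap {C D} _ {A B} _.

Definition functor_id (C : category) : functor C C :=
  @Functor C C id (fun _ _ f => f) (fun=> erefl) (fun _ _ _ _ _ => erefl).

Section FunctorComp.
Variables (C D E : category) (F : functor C D) (G : functor D E).

Lemma functor_comp_id (A : C) : fmap G (fmap F (idm A)) = idm (G (F A)).
Proof. by rewrite !fmap_id. Qed.

Lemma functor_comp_comp (A B B' : C) (f : hom A B) (g : hom B B') :
  fmap G (fmap F (comp f g)) = comp (fmap G (fmap F f)) (fmap G (fmap F g)).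
Proof. by rewrite !fmap_comp. Qed.

(* [functor_comp F G] is F followed by G. *)
Definition functor_comp : functor C E :=
  @Functor C E (fun A => G (F A)) (fun _ _ f => fmap G (fmap F f))
    functor_comp_id functor_comp_comp.

End FunctorComp.

Definition is_iso (C : category) (A B : C) (f : hom A B) : Prop :=
  exists g : hom B A, comp f g = idm A /\ comp g f = idm B.

Definition naturally_isomorphic (C D : category) (F G : functor C D) : Prop :=
  exists eta : forall A : C, hom (F A) (G A),
    (forall (A B : C) (f : hom A B),
        comp (fmap F f) (eta B) = comp (eta A) (fmap G f))
    /\ (forall A : C, is_iso (eta A)).

Definition is_equivalence (C D : category) (F : functor C D) : Prop :=
  exists G : functor D C,
    naturally_isomorphic (functor_comp F G) (functor_id C)
    /\ naturally_isomorphic (functor_comp G F) (functor_id D).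

Section QuotientModule.
Variables (R : pzRingType) (V : lmodType R) (W : submodClosed V).

(* [Quotient.quot] requires a predicate declared closed under opposite, which
   the structure [submodClosed] does not record. *)
Definition submod_pred : {pred V} := W.

Lemma submod_pred_zmod : zmod_closed submod_pred.
Proof.
split=> [|u v Wu Wv]; first exact: (rpred0 W).
by rewrite -scaleN1r; apply: (rpredD Wu); apply: rpredZ.
Qed.

HB.instance Definition _ := GRing.isZmodClosed.Build V submod_pred
  submod_pred_zmod.

Definition quotmod : Type := Quotient.quot submod_pred.

HB.instance Definition _ := GRing.Zmodule.on quotmod.
HB.instance Definition _ := EqQuotient.on quotmod.

Lemma eq_quotmod (u v : V) : (u = v %[mod quotmod]) <-> u - v \in W.
Proof.
by split=> [/eqP|uv]; [|apply/eqP];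
  rewrite -[_ == _]/(_ == _ %[mod Quotient.quot submod_pred])
          -Quotient.idealrBE.
Qed.

Definition quotmod_proj (v : V) : quotmod := \pi_quotmod v.

Lemma quotmod_projB : zmod_morphism quotmod_proj.
Proof.
move=> u v.
exact: (raddfB (\pi_(Quotient.quot submod_pred))).
Qed.

HB.instance Definition _ :=
  GRing.isZmodMorphism.Build V quotmod quotmod_proj quotmod_projB.

Definition quotmod_scale (a : R) (x : quotmod) : quotmod :=
  quotmod_proj (a *: repr x).

Lemma quotmod_scale_proj a v :
  quotmod_scale a (quotmod_proj v) = quotmod_proj (a *: v).
Proof.
apply/eq_quotmod; rewrite -scalerBr; apply: rpredZ.
by apply/eq_quotmod; rewrite reprK.
Qed.

Lemma quotmodP (x : quotmod) : {v | x = quotmod_proj v}.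
Proof. by exists (repr x); rewrite /quotmod_proj reprK. Qed.

Lemma quotmod_scaleA a b x :
  quotmod_scale a (quotmod_scale b x) = quotmod_scale (a * b) x.
Proof.
by case: (quotmodP x) => v ->; rewrite !quotmod_scale_proj scalerA.
Qed.

Lemma quotmod_scale1 : left_id 1 quotmod_scale.
Proof.
by move=> x; case: (quotmodP x) => v ->; rewrite quotmod_scale_proj scale1r.
Qed.

Lemma quotmod_scaleDr : right_distributive quotmod_scale +%R.
Proof.
move=> a x y; case: (quotmodP x) (quotmodP y) => [u ->] [v ->].
by rewrite -raddfD !quotmod_scale_proj scalerDr raddfD.
Qed.

Lemma quotmod_scaleDl x : {morph quotmod_scale^~ x : a b / a + b}.
Proof.
move=> a b; case: (quotmodP x) => v ->.
by rewrite !quotmod_scale_proj scalerDl raddfD.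
Qed.

HB.instance Definition _ := GRing.Zmodule_isLmodule.Build R quotmod
  quotmod_scaleA quotmod_scale1 quotmod_scaleDr quotmod_scaleDl.

Lemma quotmod_projZ : scalable quotmod_proj.
Proof. by move=> a v; rewrite -quotmod_scale_proj. Qed.

HB.instance Definition _ :=
  GRing.isScalable.Build R V quotmod _ quotmod_proj quotmod_projZ.

End QuotientModule.

Section Cokernel.
Variables (R : pzRingType) (r1 r0 : nat) (M : 'M[R]_(r1, r0)).

(* The submodule R^{1 x r1} M of R^{1 x r0}. *)
Definition rowspan : {pred 'rV[R]_r0} :=
  fun v => `[< exists u : 'rV[R]_r1, v = u *m M >].

Lemma rowspanP (v : 'rV[R]_r0) :
  reflect (exists u : 'rV[R]_r1, v = u *m M) (v \in rowspan).
Proof. exact: asboolP. Qed.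

Lemma rowspan_submod : subsemimod_closed rowspan.
Proof.
split; first split.
- by apply/rowspanP; exists 0; rewrite mul0mx.
- move=> _ _ /rowspanP[u ->] /rowspanP[v ->].
  by apply/rowspanP; exists (u + v); rewrite mulmxDl.
- move=> a _ /rowspanP[u ->].
  by apply/rowspanP; exists (a *: u); rewrite scalemxAl.
Qed.

HB.instance Definition _ :=
  GRing.isSubSemiModClosed.Build R 'rV[R]_r0 rowspan rowspan_submod.

Definition coker : lmodType R := quotmod rowspan.

Definition coker_proj : {linear 'rV[R]_r0 -> coker} := quotmod_proj rowspan.

Lemma coker_projP (x : coker) : {v | x = coker_proj v}.
Proof. exact: quotmodP. Qed.

Lemma coker_proj_eq (u v : 'rV[R]_r0) :
  coker_proj u = coker_proj v <-> u - v \in rowspan.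
Proof. exact: eq_quotmod. Qed.

End Cokernel.

Section CokernelEq.
Variables (R : pzRingType) (r0 : nat).

Lemma submodClosed_eq (V : lmodType R) (W W' : submodClosed V) :
  W =i W' -> W = W'.
Proof.
case: W W' => [W [[c1] [c2]]] [W' [[d1] [d2]]] /= eqW.
have {eqW}eqW : W = W' by apply/funext => v; exact: eqW.
case: _ / eqW d1 d2 => d1 d2.
by rewrite (Prop_irrelevance d1 c1) (Prop_irrelevance d2 c2).
Qed.

Lemma coker_eq r1 r1' (M : 'M[R]_(r1, r0)) (M' : 'M[R]_(r1', r0)) :
  rowspan M =i rowspan M' -> coker M = coker M'.
Proof.
move=> eqM; congr (quotmod _ : lmodType R).
exact: (submodClosed_eq eqM).
Qed.

End CokernelEq.

Lemma linear_ext (R : pzRingType) (U V : lmodType R) (f g : {linear U -> V}) :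
  f =1 g -> f = g.
Proof.
case: f g => [f cf] [g cg] /= /funext eqfg.
case: _ / eqfg cg => cg; congr GRing.Linear.Pack.
case: cf cg => [[p1] [p2]] [[q1] [q2]].
by rewrite (Prop_irrelevance q1 p1) (Prop_irrelevance q2 p2).
Qed.

Section FpMod.
Variable R : pzRingType.

(* There is an exact sequence R^{1 x m} -> R^{1 x n} -> M -> 0. *)
Definition finitely_presented (M : lmodType R) : Prop :=
  exists n m (f : {linear 'rV[R]_n -> M}) (g : {linear 'rV[R]_m -> 'rV[R]_n}),
    (forall y : M, exists x, f x = y)
    /\ (forall x : 'rV[R]_n, f x = 0 <-> exists z, g z = x).

Record fpmodType := FpMod {
  fpmod_sort :> lmodType R;
  fpmodP : finitely_presented fpmod_sort
}.

Definition lin_id (M : lmodType R) : {linear M -> M} := idfun.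

Definition lin_comp (M N P : lmodType R) (f : {linear M -> N})
  (g : {linear N -> P}) : {linear M -> P} := g \o f.

Lemma lin_comp_idl (M N : fpmodType) (f : {linear M -> N}) :
  lin_comp (lin_id M) f = f.
Proof. exact: linear_ext. Qed.

Lemma lin_comp_idr (M N : fpmodType) (f : {linear M -> N}) :
  lin_comp f (lin_id N) = f.
Proof. exact: linear_ext. Qed.

Lemma lin_compA (M N P Q : fpmodType) (f : {linear M -> N})
    (g : {linear N -> P}) (h : {linear P -> Q}) :
  lin_comp f (lin_comp g h) = lin_comp (lin_comp f g) h.
Proof. exact: linear_ext. Qed.

Definition fpmod : category :=
  @Category fpmodType (fun M N => {linear M -> N}) (fun M => lin_id M)
    (fun M N P f g => lin_comp f g) lin_comp_idl lin_comp_idr lin_compA.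

End FpMod.

Section PresMor.
Variables (R : pzRingType) (r1 r0 s1 s0 : nat).
Variables (M : 'M[R]_(r1, r0)) (L : 'M[R]_(s1, s0)).

Definition is_premor (phi : 'M[R]_(r0, s0)) : bool :=
  `[< forall v : 'rV[R]_r0, v \in rowspan M -> v *m phi \in rowspan L >].

Definition premor := {phi : 'M[R]_(r0, s0) | is_premor phi}.

Lemma premorP (phi : premor) (v : 'rV[R]_r0) :
  v \in rowspan M -> v *m val phi \in rowspan L.
Proof. by move: v; apply/asboolP/(valP phi). Qed.

Definition coker_map_fun (phi : premor) (x : coker M) : coker L :=
  coker_proj L (repr x *m val phi).

Lemma coker_map_funE phi (v : 'rV[R]_r0) :
  coker_map_fun phi (coker_proj M v) = coker_proj L (v *m val phi).
Proof.
apply/coker_proj_eq; rewrite -mulmxBl; apply: premorP.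
by apply/coker_proj_eq; exact: (reprK (coker_proj M v)).
Qed.

Lemma coker_map_fun_semilinear phi : semilinear (coker_map_fun phi).
Proof.
split=> [a x|x y].
  by case: (coker_projP x) => v ->;
    rewrite -linearZ !coker_map_funE -scalemxAl linearZ.
case: (coker_projP x) (coker_projP y) => [u ->] [v ->].
by rewrite -linearD !coker_map_funE mulmxDl linearD.
Qed.

HB.instance Definition _ phi :=
  GRing.isSemilinear.Build R (coker M) (coker L) _ (coker_map_fun phi)
    (coker_map_fun_semilinear phi).

Definition coker_map (phi : premor) : {linear coker M -> coker L} :=
  coker_map_fun phi.

Lemma coker_mapE phi (v : 'rV[R]_r0) :
  coker_map phi (coker_proj M v) = coker_proj L (v *m val phi).
Proof. exact: coker_map_funE. Qed.

Definition premor_eqv (phi psi : premor) : bool :=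
  `[< coker_map phi = coker_map psi >].

Lemma premor_eqv_equiv : equiv_class_of premor_eqv.
Proof.
split=> [phi|phi psi|psi phi chi]; first exact/asboolP.
  by apply/asboolP/asboolP.
by move=> /asboolP e1 /asboolP e2; apply/asboolP; rewrite e1.
Qed.

Canonical premor_equiv_rel := EquivRelPack premor_eqv_equiv.

Definition presmor := {eq_quot premor_eqv}.

Definition mor_class (phi : premor) : presmor := \pi_presmor phi.

Lemma mor_class_eq phi psi :
  mor_class phi = mor_class psi <-> coker_map phi = coker_map psi.
Proof. by split=> [/eqmodP/asboolP|e]; last by apply/eqmodP/asboolP. Qed.

Lemma mor_classP (f : presmor) : {phi | f = mor_class phi}.
Proof. by exists (repr f); rewrite /mor_class reprK. Qed.

Definition induced (f : presmor) : {linear coker M -> coker L} :=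
  coker_map (repr f).

Lemma induced_class phi : induced (mor_class phi) = coker_map phi.
Proof. by apply/mor_class_eq; rewrite /mor_class reprK. Qed.

Lemma induced_inj : injective induced.
Proof.
move=> f g; case: (mor_classP f) (mor_classP g) => [phi ->] [psi ->].
by rewrite !induced_class => /mor_class_eq.
Qed.

End PresMor.

Section PresMorComp.
Variable R : pzRingType.

Lemma is_premor1 r1 r0 (M : 'M[R]_(r1, r0)) : is_premor M M 1%:M.
Proof. by apply/asboolP => v; rewrite mulmx1. Qed.

Definition premor_id r1 r0 (M : 'M[R]_(r1, r0)) : premor M M :=
  exist _ 1%:M (is_premor1 M).

Definition presmor_id r1 r0 (M : 'M[R]_(r1, r0)) : presmor M M :=
  mor_class (premor_id M).

Lemma induced_id r1 r0 (M : 'M[R]_(r1, r0)) :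
  induced (presmor_id M) = lin_id (coker M).
Proof.
rewrite induced_class; apply: linear_ext => x.
by case: (coker_projP x) => v ->; rewrite coker_mapE mulmx1.
Qed.

Variables (r1 r0 s1 s0 t1 t0 : nat).
Variables (M : 'M[R]_(r1, r0)) (L : 'M[R]_(s1, s0)) (N : 'M[R]_(t1, t0)).

Lemma is_premorM (phi : premor M L) (psi : premor L N) :
  is_premor M N (val phi *m val psi).
Proof.
by apply/asboolP => v Mv; rewrite mulmxA; apply/premorP/premorP.
Qed.

Definition premor_comp (phi : premor M L) (psi : premor L N) : premor M N :=
  exist _ (val phi *m val psi) (is_premorM phi psi).

Definition presmor_comp (f : presmor M L) (g : presmor L N) : presmor M N :=
  mor_class (premor_comp (repr f) (repr g)).

Lemma coker_map_comp phi psi :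
  coker_map (premor_comp phi psi) = lin_comp (coker_map phi) (coker_map psi).
Proof.
apply: linear_ext => x; case: (coker_projP x) => v ->.
rewrite -[RHS]/(coker_map psi (coker_map phi (coker_proj M v))).
by rewrite !coker_mapE mulmxA.
Qed.

Lemma induced_comp f g :
  induced (presmor_comp f g) = lin_comp (induced f) (induced g).
Proof. by rewrite induced_class coker_map_comp. Qed.

Lemma presmor_compE (phi : premor M L) (psi : premor L N) :
  presmor_comp (mor_class phi) (mor_class psi)
  = mor_class (premor_comp phi psi).
Proof.
by apply: induced_inj; rewrite induced_comp !induced_class coker_map_comp.
Qed.

End PresMorComp.

Section FPres.
Variable R : pzRingType.

Definition presmx (r0 : nat) := {r1 : nat & 'M[R]_(r1, r0)}.

Definition presmx_eqv (r0 : nat) (M L : presmx r0) : bool :=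
  `[< rowspan (tagged M) =i rowspan (tagged L) >].

Lemma presmx_eqv_equiv r0 : equiv_class_of (@presmx_eqv r0).
Proof.
split=> [M|M L|L M N]; first exact/asboolP.
  by apply/asboolP/asboolP => e v; rewrite e.
by move=> /asboolP e1 /asboolP e2; apply/asboolP => v; rewrite e1.
Qed.

Canonical presmx_equiv_rel r0 := EquivRelPack (presmx_eqv_equiv r0).

(* The number of columns stays outside the quotient: only matrices with the
   same number of columns are ever identified. *)
Record fpresObj := FPresObj {
  ncols : nat;
  presclass : {eq_quot (@presmx_eqv ncols)}
}.

Definition presobj r1 r0 (M : 'M[R]_(r1, r0)) : fpresObj :=
  @FPresObj r0 (\pi_({eq_quot (@presmx_eqv r0)})
                  (Tagged (fun r => 'M[R]_(r, r0)) M)).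

Definition nrows (A : fpresObj) : nat := tag (repr (presclass A)).

Definition presmat (A : fpresObj) : 'M[R]_(nrows A, ncols A) :=
  tagged (repr (presclass A)).

Lemma presmatK : cancel (fun A => presobj (presmat A)) id.
Proof.
case=> r0 X; rewrite /presobj /presmat /nrows /=; congr FPresObj.
by rewrite -[RHS]reprK; case: (repr X).
Qed.

Lemma rowspan_presobj r1 r0 (M : 'M[R]_(r1, r0)) :
  rowspan (presmat (presobj M)) =i rowspan M.
Proof.
have /eqmodP/asboolP := reprK (presclass (presobj M)).
exact.
Qed.

Lemma presobj_eq r1 r1' r0 (M : 'M[R]_(r1, r0)) (L : 'M[R]_(r1', r0)) :
  presobj M = presobj L <-> rowspan M =i rowspan L.
Proof.
split=> [e|e].
  pose P A := forall h : ncols A = r0,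
    rowspan (presmat A) =i [pred v | castmx (erefl, h) v \in rowspan M].
  have: P (presobj M).
    by move=> h v; rewrite (eq_irrelevance h erefl) rowspan_presobj.
  by rewrite e => /(_ erefl) eL v; rewrite -[RHS]rowspan_presobj eL.
by congr FPresObj; apply/eqmodP/asboolP.
Qed.

Definition fpres_hom (A B : fpresObj) := presmor (presmat A) (presmat B).

Lemma fpres_comp_idl (A B : fpresObj) (f : fpres_hom A B) :
  presmor_comp (presmor_id (presmat A)) f = f.
Proof.
by apply: induced_inj; rewrite induced_comp induced_id; apply: linear_ext.
Qed.

Lemma fpres_comp_idr (A B : fpresObj) (f : fpres_hom A B) :
  presmor_comp f (presmor_id (presmat B)) = f.
Proof.
by apply: induced_inj; rewrite induced_comp induced_id; apply: linear_ext.
Qed.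

Lemma fpres_compA (A B C D : fpresObj) (f : fpres_hom A B)
    (g : fpres_hom B C) (h : fpres_hom C D) :
  presmor_comp f (presmor_comp g h) = presmor_comp (presmor_comp f g) h.
Proof.
by apply: induced_inj; rewrite !induced_comp; apply: linear_ext.
Qed.

Definition fpres : category :=
  @Category fpresObj fpres_hom (fun A => presmor_id (presmat A))
    (fun _ _ _ f g => presmor_comp f g)
    fpres_comp_idl fpres_comp_idr fpres_compA.

Lemma coker_fp r1 r0 (M : 'M[R]_(r1, r0)) : finitely_presented (coker M).
Proof.
exists r0, r1, (coker_proj M), (mulmxr M); split=> [y|x].
  by case: (coker_projP y) => v ->; exists v.
split=> [e|[z <-]].
  have /coker_proj_eq : coker_proj M x = coker_proj M 0 by rewrite e linear0.
  by rewrite subr0 => /rowspanP[u ->]; exists u.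
rewrite -(linear0 (coker_proj M)); apply/coker_proj_eq; rewrite subr0.
by apply/rowspanP; exists z.
Qed.

Definition coker_obj (A : fpres) : fpmod R :=
  @FpMod R (coker (presmat A)) (coker_fp (presmat A)).

(* [coker_obj] goes through a chosen representative of the class, but its
   value at the class of [M] is [coker M] itself. *)
Lemma coker_objE r1 r0 (M : 'M[R]_(r1, r0)) :
  coker_obj (presobj M) = FpMod (coker_fp M).
Proof.
rewrite /coker_obj; move: (coker_fp _) (coker_fp M).
rewrite (coker_eq (@rowspan_presobj _ _ M)) => p q.
by rewrite (Prop_irrelevance p q).
Qed.

Definition coker_functor : functor fpres (fpmod R) :=
  @Functor fpres (fpmod R) coker_obj (fun _ _ f => induced f)
    (fun A => induced_id (presmat A)) (fun _ _ _ f g => induced_comp f g).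

End FPres.

(* Main.v *)
From HB Require Import structures.
From mathcomp Require Import all_boot all_algebra.
From mathcomp Require Import boolp.
Require Import Defs.

(** The functor [coker] is fully faithful and hits every finitely presented
    module up to isomorphism; with the axiom of choice this makes it an
    equivalence ([fully_faithful_equivalence]).

    It is faithful because morphisms of presentations are by definition
    identified when they induce the same map of cokernels ([induced_inj]).
    It is full ([coker_full]) because the rows of length n form a free, hence
    projective, module ([free_lift]): a map coker M -> coker L, precomposed with
    the projection onto coker M, lifts through the projection onto coker L to a
    linear map between free modules, and such a map is right multiplication by
    a matrix.  It is essentially surjective ([coker_surj]) because the relations
    g : R^{1 x m} -> R^{1 x n} of a finite presentation of N are again given by
    a matrix P, so that N and coker P are two quotients of R^{1 x n} by the same
    submodule; the maps in both directions come from the universal property of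
    quotients ([factor_linear]). *)

Set Implicit Arguments.
Unset Strict Implicit.
Unset Printing Implicit Defensive.

Import GRing.Theory.
Local Open Scope ring_scope.

Section Equivalence.
Variables (C D : category) (F : functor C D).

Definition faithful := forall A B : C, injective (@fmap C D F A B).

Definition full :=
  forall (A B : C) (h : hom (F A) (F B)), exists f, fmap F f = h.

Definition essentially_surjective :=
  forall Y : D, exists (A : C) (e : hom (F A) Y), is_iso e.

(** Choose for each Y an object G Y with an isomorphism e Y from F (G Y) to Y.
    Since F is bijective on morphisms, there is one way to make G a functor
    for which e is natural: h goes to the preimage of h conjugated by e.  The
    other natural isomorphism, from G (F A) to A, is the preimage of e (F A). *)
Lemma fully_faithful_equivalence :
  faithful -> full -> essentially_surjective -> is_equivalence F.
Proof.
move=> inj surj ess.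
pose G Y := projT1 (cid (ess Y)).
pose e Y : hom (F (G Y)) Y := projT1 (cid (projT2 (cid (ess Y)))).
have iso_e Y : is_iso (e Y) := projT2 (cid (projT2 (cid (ess Y)))).
pose e' Y : hom Y (F (G Y)) := projT1 (cid (iso_e Y)).
have ee' Y : comp (e Y) (e' Y) = idm _ by case: (projT2 (cid (iso_e Y))).
have e'e Y : comp (e' Y) (e Y) = idm _ by case: (projT2 (cid (iso_e Y))).
pose pre A B (h : hom (F A) (F B)) : hom A B := projT1 (cid (surj A B h)).
have preK A B h : fmap F (pre A B h) = h := projT2 (cid (surj A B h)).
pose Gmap X Y (h : hom X Y) := pre _ _ (comp (comp (e X) h) (e' Y)).
have Gmap_id X : Gmap X X (idm X) = idm (G X).
  by apply: inj; rewrite preK comp_idr ee' fmap_id.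
have Gmap_comp X Y Z (h : hom X Y) (k : hom Y Z) :
    Gmap X Z (comp h k) = comp (Gmap X Y h) (Gmap Y Z k).
  apply: inj; rewrite fmap_comp !preK !compA.
  by rewrite -[comp (comp (comp (e X) h) (e' Y)) (e Y)]compA e'e comp_idr.
exists (Functor Gmap_id Gmap_comp); split.
- exists (fun A => pre _ _ (e (F A))); split=> [A B f|A] /=.
    by apply: inj; rewrite !fmap_comp !preK -compA e'e comp_idr.
  exists (pre _ _ (e' (F A))).
  by split; apply: inj; rewrite fmap_comp !preK fmap_id.
- exists e; split=> [X Y h|Y] /=; last exact: iso_e.
  by rewrite preK -compA e'e comp_idr.
Qed.

End Equivalence.

Section LinearMaps.
Variable R : pzRingType.

(** The universal property of V as the quotient of U by the kernel of f. *)
Lemma factor_linear (U V W : lmodType R) (f : {linear U -> V})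
    (h : {linear U -> W}) :
  (forall y, exists x, f x = y) -> (forall x, f x = 0 -> h x = 0) ->
  exists k : {linear V -> W}, forall x, k (f x) = h x.
Proof.
move=> surj ker_fh.
pose s y := projT1 (cid (surj y)).
have sK y : f (s y) = y := projT2 (cid (surj y)).
pose k y := h (s y).
have kf x : k (f x) = h x.
  by apply/eqP; rewrite -subr_eq0 -linearB ker_fh // linearB sK subrr.
have k_lin : linear k.
  by move=> a x y; rewrite -{1}(sK x) -{1}(sK y) -linearP kf linearP.
pose kM := GRing.isLinear.Build R V W *:%R k k_lin.
pose kL : {linear V -> W} := HB.pack k kM.
by exists kL.
Qed.

(** Projectivity of the free module R^{1 x n}: lifting the images of the basis
    vectors through p gives the rows of A.  For p the identity this says that
    linear maps between free modules are matrices. *)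
Lemma free_lift n m (V : lmodType R) (p : {linear 'rV[R]_m -> V})
    (h : {linear 'rV[R]_n -> V}) :
  (forall y, exists x, p x = y) ->
  exists A : 'M[R]_(n, m), forall v, p (v *m A) = h v.
Proof.
move=> surj.
pose s y := projT1 (cid (surj y)).
have sK y : p (s y) = y := projT2 (cid (surj y)).
exists (\matrix_i s (h (delta_mx 0 i))) => v.
rewrite mulmx_sum_row linear_sum [in RHS](row_sum_delta v) linear_sum.
by apply: eq_bigr => i _; rewrite rowK !linearZ /= sK.
Qed.

End LinearMaps.

Section Coker.
Variable R : pzRingType.

Lemma coker_proj_surj r1 r0 (M : 'M[R]_(r1, r0)) (x : coker M) :
  exists v, coker_proj M v = x.
Proof. by case: (coker_projP x) => v ->; exists v. Qed.

Lemma coker_proj_eq0 r1 r0 (M : 'M[R]_(r1, r0)) (v : 'rV[R]_r0) :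
  coker_proj M v = 0 <-> v \in rowspan M.
Proof. by rewrite -(linear0 (coker_proj M)) coker_proj_eq subr0. Qed.

Lemma coker_faithful : faithful (coker_functor R).
Proof. by move=> A B; exact: induced_inj. Qed.

(** A matrix lifting the given map of cokernels is a morphism of presentations:
    it takes relations to relations because the given map takes 0 to 0. *)
Lemma coker_full : full (coker_functor R).
Proof.
move=> A B h; set M := presmat A; set L := presmat B.
have [phi phiE] :=
  free_lift (lin_comp (coker_proj M) h) (@coker_proj_surj _ _ L).
have phiP : is_premor M L phi.
  apply/asboolP => v /coker_proj_eq0 v0.
  by apply/coker_proj_eq0; rewrite phiE /= v0 linear0.
exists (mor_class (exist _ phi phiP : premor M L)).
rewrite /= induced_class; apply: linear_ext => x.
by case: (coker_projP x) => v ->; rewrite coker_mapE phiE.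
Qed.

(** For the relation matrix P of a finite presentation f of N, the maps f and
    [coker_proj P] are surjective with the same kernel, so each factors through
    the other, and the two factors are mutually inverse. *)
Lemma coker_iso (N : fpmod R) :
  exists r1 r0 (P : 'M[R]_(r1, r0)) (e : hom (FpMod (coker_fp P) : fpmod R) N),
    is_iso e.
Proof.
case: N => N fpN; have [n [m [f [g [f_surj kerf]]]]] := fpN.
have [P PE] := free_lift g (p := lin_id _) (fun y => ex_intro _ y erefl).
have kerP v : f v = 0 <-> coker_proj P v = 0.
  rewrite kerf coker_proj_eq0; split=> [[z <-]|/rowspanP[u ->]].
    by apply/rowspanP; exists z; rewrite -PE.
  by exists u; rewrite -PE.
have [k kE] :=
  factor_linear (h := f) (@coker_proj_surj _ _ P) (fun v => (kerP v).2).
have [l lE] := factor_linear (h := coker_proj P) f_surj (fun v => (kerP v).1).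
exists m, n, P, k, l; split; apply: linear_ext => x /=.
  by case: (coker_projP x) => v ->; rewrite kE lE.
by case: (f_surj x) => v <-; rewrite lE kE.
Qed.

Lemma coker_surj : essentially_surjective (coker_functor R).
Proof.
move=> N; have [r1 [r0 [P isoP]]] := coker_iso N.
(* An object of presentations is a class of matrices, whose cokernel is formed
   from a chosen representative; it is nevertheless equal to coker P. *)
have cokerE : coker_functor R (presobj P) = FpMod (coker_fp P).
  exact: coker_objE.
by exists (presobj P); rewrite cokerE.
Qed.

End Coker.

Theorem proposition3p1 (R : pzRingType) : is_equivalence (coker_functor R).
Proof.
apply: fully_faithful_equivalence.
- exact: coker_faithful.
- exact: coker_full.
- exact: coker_surj.
Qed.
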